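(* Let $S_1,\ldots,S_n$ ($n\geq 1$) be i.i.d. copies of a discrete generalized Pareto random variable $S$ with tail index $\beta>0$ and slowly varying function $L$. Let $\delta\in(0,1/2)$ and set $u_n(\delta)=\ln(2/\delta)/n$. If $k\geq 1$ is such that $p_{k+1}\geq 16\,u_n(\delta)$, then, with probability at least $1-2\delta$, $$\left|\widehat{\beta}_{n}(k)-\beta\right|\leq 6\sqrt{\frac{u_n(\delta)}{p_{k+1}}}+\left|\ln\left(\frac{L(e^{k})}{L(e^{k+1})}\right)\right|.$$
   Context: $S$ is a random variable with values in $\{1,2,3,\ldots\}$ such that $\mathbb{P}(S>x)=x^{-\beta}L(x)$ for all real $x\geq 1$, where $\beta>0$ and $L:\mathbb{R}_+\to\mathbb{R}$ is slowly varying, i.e. $L(\lambda z)/L(z)\to 1$ as $z\to+\infty$ for every $\lambda>0$. For real $l$, $p_l=\mathbb{P}(S>e^{l})$ and $\widehat p^{(n)}_l=\frac1n\sum_{i=1}^n\mathbb{I}\{S_i>e^l\}$, where $\mathbb{I}$ denotes an indicator. The estimator is $\widehat\beta_n(k)=\ln(\widehat p^{(n)}_k)-\ln(\widehat p^{(n)}_{k+1})$ if $\widehat p^{(n)}_{k+1}>0$, and $\widehat\beta_n(k)=0$ if $\widehat p^{(n)}_{k+1}=0$. *)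

(* Defs.v *)
From HB Require Import structures.
From mathcomp Require Import all_boot all_order all_algebra.
From mathcomp Require Import all_classical all_reals all_analysis.

Set Implicit Arguments.
Unset Strict Implicit.
Unset Printing Implicit Defensive.

Import Order.TTheory GRing.Theory Num.Theory.
Import numFieldNormedType.Exports.

Local Open Scope classical_set_scope.
Local Open Scope ring_scope.

(* A function on the nonnegative half-line is represented by a total function
   on [R]; its values at negative arguments are never constrained. *)
Definition slowly_varying (R : realType) (L : R -> R) : Prop :=
  forall lambda : R, 0 < lambda ->
    L (lambda * z) / L z @[z --> +oo] --> (1 : R).

Definition discrete_generalized_pareto (R : realType) (d : measure_display)
    (T : measurableType d) (P : probability T R) (S : {RV P >-> nat})
    (beta : R) (L : R -> R) : Prop :=
  [/\ forall t, (1 <= S t)%N,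
      0 < beta,
      slowly_varying L
    & forall x : R, 1 <= x ->
        P [set t | x < (S t)%:R] = (x `^ (- beta) * L x)%:E].

Definition mutually_independent (R : realType) (d d' : measure_display)
    (T : measurableType d) (T' : measurableType d') (P : probability T R)
    (I : finType) (X : I -> {RV P >-> T'}) : Prop :=
  forall (J : {set I}) (A : I -> set T'), (forall i, measurable (A i)) ->
    P [set t | forall i, i \in J -> A i (X i t)] =
    (\prod_(i in J) P (X i @^-1` A i))%E.

(* The reference variable and its copies need not share a probability space. *)
Definition iid_copies (R : realType) (d0 d d' : measure_display)
    (T0 : measurableType d0) (T : measurableType d) (T' : measurableType d')
    (P0 : probability T0 R) (P : probability T R) (S : {RV P0 >-> T'})
    (I : finType) (X : I -> {RV P >-> T'}) : Prop :=
  mutually_independent X /\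
  forall (i : I) (A : set T'), measurable A ->
    distribution P (X i) A = distribution P0 S A.

Definition tail_prob (R : realType) (d : measure_display)
    (T : measurableType d) (P : probability T R) (S : {RV P >-> nat})
    (l : R) : R :=
  fine (P [set t | expR l < (S t)%:R]).

Definition empirical_tail_prob (R : realType) (d : measure_display)
    (T : measurableType d) (P : probability T R) (n : nat)
    (X : 'I_n -> {RV P >-> nat}) (l : R) (t : T) : R :=
  n%:R^-1 * \sum_(i < n) \1_[set w | expR l < (X i w)%:R] t.

Definition tail_index_estimator (R : realType) (d : measure_display)
    (T : measurableType d) (P : probability T R) (n : nat)
    (X : 'I_n -> {RV P >-> nat}) (k : R) (t : T) : R :=
  if 0 < empirical_tail_prob X (k + 1) t
  then ln (empirical_tail_prob X k t) - ln (empirical_tail_prob X (k + 1) t)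
  else 0.

Definition deviation_level (R : realType) (n : nat) (delta : R) : R :=
  ln (2 / delta) / n%:R.

(* Main.v *)
Require Import Defs.
From HB Require Import structures.
From mathcomp Require Import all_boot all_order all_algebra.
From mathcomp Require Import all_classical all_reals all_analysis.
From mathcomp Require Import measurable_realfun ring lra.
Import Order.TTheory GRing.Theory Num.Theory.
Import numFieldNormedType.Exports.
Local Open Scope classical_set_scope.
Local Open Scope ring_scope.

(** Write [p_l] for the tail probability at level [l], [q] for [p_(k+1)], [u]
    for the deviation level, and [e = 2 * sqrt (u / q)]; the hypothesis
    [16 * u <= q] says exactly that [e <= 1/2].

    The number of samples exceeding a level is binomial, so Chernoff's method
    bounds the probability that an empirical tail misses [p_l] by a relative
    error [e], on either side, by [exp (- n * p_l * e ^ 2 / 4)]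
    ([empirical_tail_deviation]).  Since [p_k >= p_(k+1) = q] and
    [n * q * e ^ 2 / 4 = ln (2 / delta)], this is at most [delta / 2], and the
    four failures (two levels, two sides) have total probability at most
    [2 * delta].

    When none of them occurs, each difference of logarithms between an
    empirical tail and the true one lies in [[- 2 * e, e]]
    ([ln_ratio_bounds]).  The estimator subtracts two such differences, so it
    is within [3 * e = 6 * sqrt (u / q)] of [ln p_k - ln p_(k+1)].  The power
    [x `^ (- beta)] contributes exactly [beta] to the latter, and what remains
    is the bias [ln (L (e ^ k) / L (e ^ (k+1)))]
    ([tail_index_estimator_error]). *)

(** * Elementary inequalities *)

(** Squaring [1 - y / 2 <= exp (- y / 2)] gives
    [exp y * (1 - y / 2) ^ 2 <= 1], and this square times the right-hand side
    is at least [1] as long as [1 - 3 * y + y ^ 2 >= 0]. *)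
Lemma expR_le_quadratic {R : realType} (y : R) :
  `|y| <= 1 / 4 -> expR y <= 1 + y + y ^+ 2.
Proof.
rewrite ler_norml => /andP[y_ge y_le].
have half_le : 1 - y / 2 <= expR (- (y / 2)) by exact: expR_ge1Dx.
have half_gt0 : 0 < 1 - y / 2 by lra.
have expR_half : expR y * expR (- (y / 2)) ^+ 2 = 1.
  by rewrite expr2 -!expRD -[RHS](@expR0 R); congr expR; lra.
rewrite -(ler_pM2r (exprn_gt0 2 half_gt0)).
apply: (@le_trans _ _ 1).
  rewrite -[leRHS]expR_half ler_pM2l ?expR_gt0// lerXn2r// nnegrE.
    exact: ltW.
  exact: expR_ge0.
have -> : (1 + y + y ^+ 2) * (1 - y / 2) ^+ 2 =
          1 + y ^+ 2 * (1 - 3 * y + y ^+ 2) / 4 by field.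
rewrite lerDl divr_ge0// mulr_ge0 ?sqr_ge0//.
by have := sqr_ge0 y; lra.
Qed.

(** The two sides are not symmetric: for [e <= 1/2] the inverse of [1 - e] is
    only bounded by [1 + 2 * e].  In a difference of two such logarithms the
    extremes are [2 * e + e], so this cruder lower bound still leads to
    [3 * e] there. *)
Lemma ln_ratio_bounds {R : realType} {p q e : R} :
  0 < p -> 0 <= e <= 1 / 2 -> (1 - e) * p < q < (1 + e) * p ->
  - (2 * e) <= ln q - ln p <= e.
Proof.
move=> p_gt0 /andP[e_ge0 e_le] /andP[q_gt q_lt].
have q_gt0 : 0 < q by apply: lt_trans q_gt; rewrite mulr_gt0//; lra.
apply/andP; split.
  rewrite lerNl opprB -ln_div ?posrE//.
  apply: (@le_trans _ _ (ln (1 + 2 * e))); last by apply: le_ln1Dx; lra.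
  rewrite ler_ln ?posrE ?divr_gt0//; last by lra.
  rewrite ler_pdivrMr//.
  apply: (@le_trans _ _ ((1 + 2 * e) * ((1 - e) * p))); last first.
    by rewrite ler_wpM2l//; [lra | exact: ltW].
  by rewrite mulrA ler_peMl//; [exact: ltW | nra].
rewrite -ln_div ?posrE//.
apply: (@le_trans _ _ (ln (1 + e))); last by apply: le_ln1Dx; lra.
rewrite ler_ln ?posrE ?divr_gt0//; last by lra.
by rewrite ler_pdivrMr// ltW.
Qed.

(** * Chernoff bounds for the number of independent events that occur *)

Lemma measure_bigcup_le {R : realFieldType} {d : measure_display}
    {T : ringOfSetsType d} (mu : {content set T -> \bar R}) {I : finType}
    (Q : {pred I}) {F : I -> set T} :
  (forall i, measurable (F i)) ->
  (mu (\bigcup_(i in [set` Q]) F i) <= \sum_(i in Q) mu (F i))%E.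
Proof.
move=> mF; rewrite bigcup_pred.
suff [] : measurable (\big[setU/set0]_(i in Q) F i) /\
  (mu (\big[setU/set0]_(i in Q) F i) <= \sum_(i in Q) mu (F i))%E by [].
apply: (big_ind2 (fun A x => measurable A /\ (mu A <= x)%E)) => //.
- by rewrite measure0.
- move=> A x B y [mA Ax] [mB By]; split; first exact: measurableU.
  exact: le_trans (measureU2 _ mA mB) (leeD Ax By).
Qed.

Section Hits.
Context {R : realType} {d d' : measure_display} {T : measurableType d}
  {T' : measurableType d'} {P : probability T R} {I : finType}
  (X : I -> {RV P >-> T'}) {A : set T'} (mA : measurable A).

(** Recording which indices hit [A] turns every event about the number of hits
    into a finite union of events whose probability independence gives
    directly; the moment generating function is then a finite sum. *)
Definition hits (t : T) : {set I} := finset (fun i => X i t \in A).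

Lemma hits_eq (J : {set I}) : [set t | hits t = J] =
  [set t | forall i, i \in [set: I]%SET ->
    (if i \in J then A else ~` A) (X i t)].
Proof.
apply/seteqP; split=> t /=.
  move=> <- i _; rewrite inE; case: ifP => [/set_mem//|/negbT/negP notA XA].
  by apply: notA; exact/mem_set.
move=> XJ; apply/setP => i; have := XJ i (finset.in_setT _).
rewrite inE; case: (i \in J) => [?|?]; first by apply/mem_set.
exact/memNset.
Qed.

Lemma measurable_hits (J : {set I}) : measurable [set t | hits t = J].
Proof.
rewrite hits_eq (_ : [set t | _] =
    \bigcap_(i in [set: I]) (X i @^-1` (if i \in J then A else ~` A))).
  apply: fin_bigcap_measurable => // i _; apply: measurable_funPTI.
  by case: ifP => // _; exact: measurableC.
by apply/seteqP; split=> t h i => [_|_]; apply: h => //; rewrite finset.in_setT.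
Qed.

Context (indepX : mutually_independent X) {p : R}
  (hit_prob : forall i, P (X i @^-1` A) = p%:E).

Lemma hits_prob (J : {set I}) : P [set t | hits t = J] =
  (\prod_i (if i \in J then p else 1 - p))%:E.
Proof.
rewrite hits_eq (indepX [set: I]%SET (fun i => if i \in J then A else ~` A));
  last by move=> i; case: ifP => // _; exact: measurableC.
rewrite -prodEFin; apply: eq_big => [i|i _]; first exact: finset.in_setT.
case: ifP => // _; rewrite preimage_setC probability_setC ?hit_prob//.
exact: measurable_funPTI.
Qed.

(** Markov's inequality for the exponential of [theta] times the number of
    hits; a negative [theta] gives the lower tail. *)
Lemma hits_chernoff (theta a : R) :
  (P [set t | (a <= theta * #|hits t|%:R)%R] <=
   (expR (- a) * (1 - p + p * expR theta) ^+ #|I|)%:E)%E.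
Proof.
pose Q (J : {set I}) := a <= theta * #|J|%:R.
have -> : [set t | a <= theta * #|hits t|%:R] =
    \bigcup_(J in [set` Q]) [set t | hits t = J].
  by apply/seteqP; split=> t /= => [Qt|[J QJ ->]//]; exists (hits t).
apply: le_trans (measure_bigcup_le P Q measurable_hits) _.
rewrite (eq_bigr _ (fun J _ => hits_prob J)) sumEFin lee_fin.
have prod_ge0 (J : {set I}) : 0 <= \prod_i (if i \in J then p else 1 - p).
  apply: prodr_ge0 => i _.
  have : (0%:E <= (p%:E : \bar R) <= 1%:E)%E.
    rewrite -(hit_prob i) measure_ge0 probability_le1//.
    exact: measurable_funPTI.
  by rewrite !lee_fin => /andP[? ?]; case: ifP; lra.
(* the weight is at least 1 on the patterns of the event, and nonnegative on
   the others *)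
apply: (@le_trans _ _ (\sum_(J : {set I}) expR (theta * #|J|%:R - a) *
    \prod_i (if i \in J then p else 1 - p))).
  rewrite big_mkcond; apply: ler_sum => J _; case: ifP => [QJ|_].
    by rewrite ler_peMl// -[leLHS]expR0 ler_expR subr_ge0.
  by rewrite mulr_ge0// expR_ge0.
(* the weighted sum factors over the indices *)
have -> : (1 - p + p * expR theta) ^+ #|I| =
    \sum_(J : {set I}) \prod_i (if i \in J then p * expR theta else 1 - p).
  rewrite addrC -prodr_const.
  exact: (@bigA_distr _ _ _ _ +%R I (fun=> p * expR theta) (fun=> 1 - p)).
rewrite mulr_sumr le_eqVlt; apply/orP; left; apply/eqP.
apply: eq_bigr => J _.
have -> : expR (theta * #|J|%:R - a) =
    expR (- a) * \prod_i (if i \in J then expR theta else 1).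
  by rewrite -big_mkcond prodr_const -expRM_natr -expRD addrC.
rewrite -mulrA -big_split /=; congr (_ * _); apply: eq_bigr => i _.
by case: ifP => _; rewrite ?mul1r// mulrC.
Qed.

(** Multiplying the deviation event by the signed relative error [s] treats
    both tails at once: [s > 0] is the upper one, [s < 0] the lower one.  With
    [theta = s / 2] and mean [m], the exponent is at most
    [m * (s / 2 + s ^ 2 / 4 - s / 2 * (1 + s)) = - m * s ^ 2 / 4]. *)
Lemma hits_relative_deviation (s : R) : 0 <= p -> `|s| <= 1 / 2 ->
  (P [set t | (s * ((1 + s) * (#|I|%:R * p)) <= s * #|hits t|%:R)%R] <=
   (expR (- (#|I|%:R * p * s ^+ 2 / 4)))%:E)%E.
Proof.
move=> p_ge0 s_le.
have -> : [set t | s * ((1 + s) * (#|I|%:R * p)) <= s * #|hits t|%:R] =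
    [set t | s / 2 * ((1 + s) * (#|I|%:R * p)) <= s / 2 * #|hits t|%:R].
  by apply/seteqP; split=> t /=; lra.
apply: le_trans (hits_chernoff _ _) _; rewrite lee_fin.
have exp_le : expR (s / 2) <= 1 + s / 2 + (s / 2) ^+ 2.
  by apply: expR_le_quadratic; move: s_le; rewrite !ler_norml; lra.
have mgf_le : (1 - p + p * expR (s / 2)) ^+ #|I| <=
    expR (#|I|%:R * (p * (expR (s / 2) - 1))).
  have [i _|I0] := pickP I; last by rewrite (eq_card0 I0) expr0 mul0r expR0.
  have p_le1 : p <= 1.
    rewrite -lee_fin -(hit_prob i) probability_le1//.
    exact: measurable_funPTI.
  rewrite expRM_natl lerXn2r ?nnegrE ?expR_ge0//.
    by rewrite addr_ge0 ?subr_ge0// mulr_ge0// expR_ge0.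
  by apply: le_trans (expR_ge1Dx _); lra.
apply: le_trans (ler_wpM2l (expR_ge0 _) mgf_le) _.
rewrite -expRD ler_expR.
have mean_ge0 : 0 <= #|I|%:R * p by rewrite mulr_ge0.
have := ler_wpM2l mean_ge0 exp_le; lra.
Qed.
End Hits.
Arguments hits {R d d' T T' P I} X A t.

(** * Tail probabilities and their empirical counterparts *)

Definition exceedance (R : realType) (l : R) : set nat :=
  [set m | expR l < m%:R].

Lemma measurable_exceedance (R : realType) (l : R) :
  measurable (exceedance R l).
Proof. by []. Qed.

Lemma ln_tail_prob {R : realType} {d : measure_display} {T : measurableType d}
    {P : probability T R} {S : {RV P >-> nat}} {beta : R} {L : R -> R} {l : R} :
  discrete_generalized_pareto S beta L -> 0 <= l -> 0 < tail_prob S l ->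
  0 < L (expR l) /\ ln (tail_prob S l) = - beta * l + ln (L (expR l)).
Proof.
move=> [_ _ _ tailE] l_ge0.
have el_ge1 : 1 <= expR l by rewrite -expR0 ler_expR.
rewrite /tail_prob tailE//= => tail_gt0.
have pow_gt0 : 0 < expR l `^ (- beta) by apply: powR_gt0; exact: expR_gt0.
have L_gt0 : 0 < L (expR l) by rewrite -(pmulr_rgt0 _ pow_gt0).
by rewrite lnM ?posrE// ln_powR expRK.
Qed.

Lemma tail_prob_anti {R : realType} {d : measure_display}
    {T : measurableType d} {P : probability T R} (S : {RV P >-> nat}) :
  {homo tail_prob S : l m / l <= m >-> m <= l}.
Proof.
move=> l m lm; rewrite /tail_prob.
have mexc (x : R) : measurable [set t | expR x < (S t)%:R].
  exact: (measurable_funPTI S (measurable_exceedance R x)).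
apply: fine_le; rewrite ?fin_num_measure//.
apply: le_measure; rewrite ?inE// => t /=.
by apply: le_lt_trans; rewrite ler_expR.
Qed.

Lemma exceedance_prob {R : realType} {d0 d : measure_display}
    {T0 : measurableType d0} {T : measurableType d} {P0 : probability T0 R}
    {P : probability T R} {S : {RV P0 >-> nat}} {I : finType}
    {X : I -> {RV P >-> nat}} (hX : iid_copies S X) (l : R) (i : I) :
  P (X i @^-1` exceedance R l) = (tail_prob S l)%:E.
Proof.
have := hX.2 i _ (measurable_exceedance R l).
rewrite /distribution /pushforward => ->; rewrite /tail_prob fineK//.
apply: fin_num_measure.
exact: (measurable_funPTI S (measurable_exceedance R l)).
Qed.

Lemma empirical_tail_probE {R : realType} {d : measure_display}
    {T : measurableType d} {P : probability T R} {n : nat}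
    (X : 'I_n -> {RV P >-> nat}) (l : R) (t : T) :
  empirical_tail_prob X l t = #|hits X (exceedance R l) t|%:R / n%:R.
Proof.
rewrite /empirical_tail_prob mulrC -sum1_card natr_sum [in RHS]big_mkcond/=.
congr (_ / _); apply: eq_bigr => i _; rewrite indicE inE.
by rewrite (_ : (t \in _) = (X i t \in exceedance R l))//; case: ifP.
Qed.

Lemma measurable_empirical_tail_prob {R : realType} {d : measure_display}
    {T : measurableType d} {P : probability T R} {n : nat}
    (X : 'I_n -> {RV P >-> nat}) (l : R) :
  measurable_fun setT (empirical_tail_prob X l).
Proof.
apply: measurable_funM => //; apply: measurable_sum => i.
apply: measurable_indic.
exact: (measurable_funPTI (X i) (measurable_exceedance R l)).
Qed.

Lemma measurable_tail_index_estimator {R : realType} {d : measure_display}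
    {T : measurableType d} {P : probability T R} {n : nat}
    (X : 'I_n -> {RV P >-> nat}) (k : R) :
  measurable_fun setT (tail_index_estimator X k).
Proof.
have mp l := measurable_empirical_tail_prob X l.
apply: measurable_fun_ifT => //; first exact: measurable_fun_ltr.
by apply: measurable_funB; apply: measurableT_comp.
Qed.

Lemma empirical_tail_deviation {R : realType} {d0 d : measure_display}
    {T0 : measurableType d0} {T : measurableType d} {P0 : probability T0 R}
    {P : probability T R} {S : {RV P0 >-> nat}} {n : nat}
    {X : 'I_n -> {RV P >-> nat}} (l s : R) :
  (1 <= n)%N -> iid_copies S X -> `|s| <= 1 / 2 ->
  (P [set t | (s * ((1 + s) * tail_prob S l) <=
               s * empirical_tail_prob X l t)%R] <=
   (expR (- (n%:R * tail_prob S l * s ^+ 2 / 4)))%:E)%E.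
Proof.
move=> n_ge1 hX s_le.
have n_gt0 : 0 < n%:R :> R by rewrite ltr0n.
have tail_ge0 : 0 <= tail_prob S l by apply: fine_ge0; exact: measure_ge0.
have := hits_relative_deviation X (measurable_exceedance R l) hX.1
  (exceedance_prob hX l) s tail_ge0 s_le.
rewrite card_ord; congr ((P _ <= _)%E); apply/funext => t /=.
rewrite empirical_tail_probE mulrA [s * (#|_|%:R / _)]mulrA ler_pdivlMr//.
by rewrite -!mulrA [tail_prob S l * _]mulrC.
Qed.

(** * The estimator *)

(** The bias is the remainder of
    [ln p_k - ln p_(k+1) = beta + ln (L (e ^ k)) - ln (L (e ^ (k+1)))].  For the
    fluctuation no triangle inequality is taken: the two relative errors
    range over [[- 2 * e, e]], and only their difference, at most [3 * e],
    enters. *)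
Lemma tail_index_estimator_error {R : realType} {d0 d : measure_display}
    {T0 : measurableType d0} {T : measurableType d}
    {P0 : probability T0 R} {P : probability T R}
    {S : {RV P0 >-> nat}} {beta : R} {L : R -> R} {n : nat}
    {X : 'I_n -> {RV P >-> nat}} (k e : R) (t : T) :
  discrete_generalized_pareto S beta L -> 0 <= k ->
  0 < tail_prob S (k + 1) -> 0 <= e <= 1 / 2 ->
  (forall l, l \in [:: k; k + 1] ->
    (1 - e) * tail_prob S l < empirical_tail_prob X l t
      < (1 + e) * tail_prob S l) ->
  `|tail_index_estimator X k t - beta| <=
    3 * e + `|ln (L (expR k) / L (expR (k + 1)))|.
Proof.
move=> hS k_ge0 q_gt0 e_bnd close.
have p_gt0 : 0 < tail_prob S k.
  by apply: lt_le_trans q_gt0 _; apply: tail_prob_anti; rewrite lerDl.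
have [Lk_gt0 lnp] := ln_tail_prob hS k_ge0 p_gt0.
have [Lk1_gt0 lnq] := ln_tail_prob hS (addr_ge0 k_ge0 ler01) q_gt0.
have close_k := close k; rewrite mem_head in close_k.
have close_k1 := close (k + 1); rewrite !inE eqxx orbT in close_k1.
have /andP[devk devk'] := ln_ratio_bounds p_gt0 e_bnd (close_k isT).
have /andP[devk1 devk1'] := ln_ratio_bounds q_gt0 e_bnd (close_k1 isT).
(* the estimator is not in its default branch *)
have phat_gt0 : 0 < empirical_tail_prob X (k + 1) t.
  have /andP[+ _] := close_k1 isT; apply: le_lt_trans.
  by rewrite mulr_ge0 ?ltW//; lra.
rewrite /tail_index_estimator phat_gt0 ln_div ?posrE//.
set bias := ln _ - ln (L _); set hat := ln _ - ln _.
have -> : hat - beta =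
    (hat - (ln (tail_prob S k) - ln (tail_prob S (k + 1)))) + bias.
  by rewrite lnp lnq /bias; lra.
apply: le_trans (ler_normD _ _) _; rewrite lerD2r ler_norml /hat.
by apply/andP; split; lra.
Qed.

Theorem proposition2p1 (R : realType) (d0 d : measure_display)
    (T0 : measurableType d0) (T : measurableType d)
    (P0 : probability T0 R) (P : probability T R)
    (S : {RV P0 >-> nat}) (beta : R) (L : R -> R)
    (hS : discrete_generalized_pareto S beta L)
    (n : nat) (hn : (1 <= n)%N)
    (X : 'I_n -> {RV P >-> nat}) (hX : iid_copies S X)
    (delta : R) (hdelta0 : 0 < delta) (hdelta1 : delta < 1 / 2)
    (k : R) (hk : 1 <= k)
    (hp : 16 * deviation_level n delta <= tail_prob S (k + 1)) :
  ((1 - 2 * delta)%:E <=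
    P [set t | (`|tail_index_estimator X k t - beta| <=
      6 * Num.sqrt (deviation_level n delta / tail_prob S (k + 1))
      + `|ln (L (expR k) / L (expR (k + 1)))|)%R])%E.
Proof.
set u := deviation_level n delta in hp *.
set q := tail_prob S (k + 1) in hp *.
have n_gt0 : 0 < n%:R :> R by rewrite ltr0n.
have ln_gt0 : 0 < ln (2 / delta).
  by rewrite ln_gt0// ltr_pdivlMr//; lra.
have u_gt0 : 0 < u by exact: divr_gt0.
have q_gt0 : 0 < q by lra.
have uq_gt0 : 0 < u / q by exact: divr_gt0.
pose e := 2 * Num.sqrt (u / q).
have e_gt0 : 0 < e by rewrite mulr_gt0// sqrtr_gt0.
have e_sqr : e ^+ 2 = 4 * (u / q).
  by rewrite exprMn sqr_sqrtr ?ltW//; lra.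
have e_le : e <= 1 / 2.
  have half_ge0 : 0 <= 1 / 2 :> R by lra.
  rewrite -(ler_pXn2r (ltn0Sn 1)) ?nnegrE ?(ltW e_gt0)//.
  by rewrite e_sqr mulrA ler_pdivrMr//; lra.
have -> : 6 * Num.sqrt (u / q) = 3 * e by rewrite /e; lra.
(* the four failures: [b.1] selects the side and [b.2] the level *)
pose sgn (b : bool) := if b then e else - e.
pose level (b : bool) := if b then k else k + 1.
pose bad (b : bool * bool) := [set t |
  sgn b.1 * ((1 + sgn b.1) * tail_prob S (level b.2)) <=
  sgn b.1 * empirical_tail_prob X (level b.2) t].
set good := [set t | _].
have mgood : measurable good.
  rewrite -[good]setTI; apply: measurable_fun_le => //.
  apply: measurableT_comp => //; apply: measurable_funB => //.
  exact: measurable_tail_index_estimator.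
have mbad b : measurable (bad b).
  rewrite -[bad b]setTI; apply: measurable_fun_le => //.
  apply: measurable_funM => //; exact: measurable_empirical_tail_prob.
have tail_ge b : q <= tail_prob S (level b).
  by case: b => //=; apply: tail_prob_anti; rewrite lerDl.
have bad_le b : (P (bad b) <= (delta / 2)%:E)%E.
  apply: le_trans (empirical_tail_deviation _ _ hn hX _) _.
    by rewrite /sgn; case: ifP => _; rewrite ?normrN ger0_norm// ltW.
  have -> : delta / 2 = expR (- ln (2 / delta)).
    by rewrite expRN lnK ?posrE ?divr_gt0// invf_div.
  rewrite lee_fin ler_expR lerN2.
  have -> : sgn b.1 ^+ 2 = 4 * (u / q).
    by rewrite /sgn; case: ifP; rewrite ?sqrrN.
  have -> : ln (2 / delta) = n%:R * q * (4 * (u / q)) / 4.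
    by rewrite /u /deviation_level; field; rewrite !gt_eqF.
  by rewrite ler_pM2r// ler_wpM2r ?ler_wpM2l// -e_sqr sqr_ge0.
have good_sub : ~` good `<=` \bigcup_(b in [set` predT]) bad b.
  move=> t; apply: contra_notP => not_bad.
  apply: (tail_index_estimator_error k e t hS) => //.
  - exact: le_trans hk.
  - by rewrite e_le ltW.
  have close c : (1 - e) * tail_prob S (level c) <
      empirical_tail_prob X (level c) t < (1 + e) * tail_prob S (level c).
    apply/andP; split; rewrite ltNge; apply/negP => far; apply: not_bad.
      by exists (false, c) => //; rewrite /bad/= !mulNr lerN2 ler_pM2l.
    by exists (true, c) => //; rewrite /bad/= ler_pM2l.
  by move=> l; rewrite !inE => /orP[]/eqP->; [exact: (close true) |
    exact: (close false)].
have Pbad : (P (~` good) <= (2 * delta)%:E)%E.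
  apply: le_trans (le_trans (measure_bigcup_le P predT mbad) _).
    apply: le_measure => //; rewrite inE; first exact: measurableC.
    by apply: fin_bigcup_measurable.
  apply: le_trans (lee_sum _ (fun b _ => bad_le b)) _.
  by rewrite sumEFin lee_fin sumr_const card_prod card_bool -mulr_natr; lra.
rewrite -[good]setCK probability_setC; last exact: measurableC.
by rewrite EFinB leeB.
Qed.
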